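(* Fix an integer $n\ge 1$. For each integer $m\ge n$ let $\bm{\Delta}_m$ be a random matrix uniformly distributed in the unit spectral norm ball $B_{n,m}=\{\bm{\Delta}\in\mathbb{R}^{n\times m}:\sigma_{\max}(\bm{\Delta})\le 1\}$, where all the $\bm{\Delta}_m$ are defined on a common probability space. Let $\sigma_n(\bm{\Delta}_m)$ denote the smallest of the $n$ singular values $\sigma_1(\bm{\Delta}_m)\ge\sigma_2(\bm{\Delta}_m)\ge\dots\ge\sigma_n(\bm{\Delta}_m)\ge 0$ of $\bm{\Delta}_m$. Then $\lim_{m\to\infty}\sigma_n(\bm{\Delta}_m)=1$ almost surely.
   Context: For integers $m\ge n\ge 1$ and a matrix $\bm{\Delta}\in\mathbb{R}^{n\times m}$, the singular values are $\sigma_1(\bm{\Delta})\ge\dots\ge\sigma_n(\bm{\Delta})\ge 0$ (counted with multiplicity), and $\sigma_{\max}(\bm{\Delta})=\sigma_1(\bm{\Delta})$ is the spectral norm. The uniform distribution on $B_{n,m}=\{\bm{\Delta}\in\mathbb{R}^{n\times m}:\sigma_{\max}(\bm{\Delta})\le 1\}$ is normalized Lebesgue measure on $\mathbb{R}^{n\times m}\cong\mathbb{R}^{nm}$ restricted to $B_{n,m}$. No assumption is made on the joint distribution of the matrices $\bm{\Delta}_m$ for different $m$. *)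

(* Defs.v *)
From HB Require Import structures.
From mathcomp Require Import all_boot all_order all_algebra.
From mathcomp Require Import polyrcf.
From mathcomp Require Import all_classical all_reals all_analysis.

Set Implicit Arguments.
Unset Strict Implicit.
Unset Printing Implicit Defensive.

Import Order.TTheory GRing.Theory Num.Theory.
Import numFieldNormedType.Exports.

Local Open Scope classical_set_scope.
Local Open Scope ring_scope.

Section measurable_matrix.
Context {R : realType} (m n : nat).

(* The library has no sigma-algebra on matrices. We take the product
   sigma-algebra, generated by the coordinate maps D |-> D i j; over R this is
   the Borel sigma-algebra of R^(m * n). *)
Definition mx_coord_sets : set (set 'M[R]_(m, n)) :=
  [set A | exists i j (Y : set R), measurable Y /\
     A = [set D : 'M[R]_(m, n) | Y (D i j)]].

Let mx_set0 : <<s mx_coord_sets >> set0.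
Proof. exact: sigma_algebra0. Qed.

Let mx_setC A : <<s mx_coord_sets >> A -> <<s mx_coord_sets >> (~` A).
Proof. exact: sigma_algebraC. Qed.

Let mx_bigcup (F : (set 'M[R]_(m, n))^nat) :
  (forall i, <<s mx_coord_sets >> (F i)) ->
  <<s mx_coord_sets >> (\bigcup_i F i).
Proof. exact: sigma_algebra_bigcup. Qed.

HB.instance Definition _ := @isMeasurable.Build default_measure_display
  'M[R]_(m, n) <<s mx_coord_sets >> mx_set0 mx_setC mx_bigcup.

Lemma measurable_mx_entry i j :
  measurable_fun [set: 'M[R]_(m, n)] (fun D => D i j).
Proof.
move=> _ Y mY; rewrite setTI; apply: sub_sigma_algebra.
by exists i, j, Y.
Qed.

Lemma measurable_fun_mxP d (T : measurableType d) (f : T -> 'M[R]_(m, n)) :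
  measurable_fun setT f <-> forall i j, measurable_fun setT (fun t => f t i j).
Proof.
split=> [mf i j|mf].
  by apply: (@measurableT_comp _ _ _ _ _ _ (fun D : 'M[R]_(m, n) => D i j));
    [exact: measurable_mx_entry|].
apply: (@measurability _ _ _ _ _ _ mx_coord_sets) => // _ [_ [i [j [Y [mY ->]]]] <-].
by have := mf i j measurableT Y mY.
Qed.

End measurable_matrix.

Section lebesgue_measure_matrix.
Context {R : realType}.

Definition row_cons n (p : 'rV[R]_n * R) : 'rV[R]_n.+1 :=
  row_mx (p.2%:M : 'rV_1) p.1.

Lemma row_cons0 n (p : 'rV[R]_n * R) i : row_cons p i ord0 = p.2.
Proof.
rewrite (_ : ord0 = lshift n (ord0 : 'I_1)); last exact: val_inj.
by rewrite /row_cons (@row_mxEl R 1 1 n) mxE ord1.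
Qed.

Lemma row_consS n (p : 'rV[R]_n * R) i j :
  row_cons p i (lift ord0 j) = p.1 i j.
Proof.
rewrite (_ : lift ord0 j = rshift 1 j); last exact: val_inj.
by rewrite /row_cons (@row_mxEr R 1 1 n).
Qed.

Lemma measurable_row_cons n :
  measurable_fun [set: 'rV[R]_n * R] (@row_cons n).
Proof.
apply/measurable_fun_mxP => i j; case: (unliftP ord0 j) => [k ->|->].
  apply: (eq_measurable_fun (fun p : 'rV[R]_n * R => p.1 i k)).
    by move=> p _; rewrite row_consS.
  by apply: (@measurableT_comp _ _ _ _ _ _ (fun D : 'rV[R]_n => D i k));
    [exact: measurable_mx_entry|].
by apply: (eq_measurable_fun snd) => // p _; rewrite row_cons0.
Qed.
HB.instance Definition _ n :=
  isMeasurableFun.Build _ _ _ _ (@row_cons n) (@measurable_row_cons n).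

Definition lebesgue_cons n (mu : {measure set 'rV[R]_n -> \bar R}) :
    set 'rV[R]_n.+1 -> \bar R :=
  pushforward (mu \x @lebesgue_measure R)%E (@row_cons n).

Section lebesgue_cons_measure.
Variables (n : nat) (mu : {measure set 'rV[R]_n -> \bar R}).

Let preimage_row_cons A : measurable A -> measurable (@row_cons n @^-1` A).
Proof. by move=> mA; rewrite -[X in measurable X]setTI; exact: measurable_row_cons. Qed.

Let lebesgue_cons0 : lebesgue_cons mu set0 = 0%E.
Proof. by rewrite /lebesgue_cons /pushforward preimage_set0 measure0. Qed.

Let lebesgue_cons_ge0 A : (0 <= lebesgue_cons mu A)%E.
Proof. exact: (measure_ge0 (mu \x @lebesgue_measure R)%E). Qed.

Let lebesgue_cons_sigma_additive : semi_sigma_additive (lebesgue_cons mu).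
Proof.
move=> F mF tF mUF; rewrite /lebesgue_cons /pushforward preimage_bigcup.
apply: measure_semi_sigma_additive.
- by move=> k; exact: preimage_row_cons.
- apply/trivIsetP => /= i j _ _ ij; rewrite -preimage_setI.
  by move/trivIsetP : tF => /(_ _ _ _ _ ij) ->//; rewrite preimage_set0.
- by rewrite -preimage_bigcup; exact: preimage_row_cons.
Qed.

HB.instance Definition _ := isMeasure.Build _ _ _ (lebesgue_cons mu)
  lebesgue_cons0 lebesgue_cons_ge0 lebesgue_cons_sigma_additive.

End lebesgue_cons_measure.

(* Lebesgue measure on R^n (restricted to Borel sets), as the n-fold product of
   the one-dimensional one, transported along row_cons at each step. See
   lebesgue_rV_box for its value on boxes. *)
Fixpoint lebesgue_rV n : {measure set 'rV[R]_n -> \bar R} :=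
  if n is k.+1 then lebesgue_cons (lebesgue_rV k) else \d_(0 : 'rV[R]_0).

Lemma lebesgue_rV_box n (a b : 'I_n -> R) : (forall i, a i <= b i) ->
  lebesgue_rV n [set v | forall i, a i <= v ord0 i <= b i] =
  (\prod_(i < n) (b i - a i))%:E.
Proof.
elim: n a b => [|n IH] a b ab.
  by rewrite big_ord0 /= diracE mem_set// => -[].
rewrite /= /lebesgue_cons /pushforward.
rewrite (_ : _ @^-1` _ =
  [set v : 'rV[R]_n | forall i, a (lift ord0 i) <= v ord0 i <= b (lift ord0 i)]
   `*` `[a ord0, b ord0]); last first.
  apply/seteqP; split=> -[v x]; rewrite /= in_itv/=.
    move=> H; split=> [i|]; first by have := H (lift ord0 i); rewrite row_consS.
    by have := H ord0; rewrite row_cons0.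
  by move=> [Hv Hx] i; case: (unliftP ord0 i) => [j ->|->];
    [rewrite row_consS|rewrite row_cons0].
rewrite product_measure1E//=; last first.
  rewrite [X in measurable X](_ : _ = \bigcap_(i in [set: 'I_n])
    ((fun v : 'rV[R]_n => v ord0 i) @^-1` `[a (lift ord0 i), b (lift ord0 i)])).
    apply: fin_bigcap_measurable => // i _.
    by rewrite -[X in measurable X]setTI; apply: measurable_mx_entry.
  by apply/seteqP; split=> v /= H i; [move=> _|]; have := H i;
    rewrite /= in_itv/=//; apply.
rewrite IH// lebesgue_measure_itv/= lte_fin big_ord_recl mulrC.
have := ab ord0; rewrite le_eqVlt => /predU1P[->|->]; last by rewrite -EFinD -EFinM.
by rewrite ltxx subrr mulr0 mule0.
Qed.

(* R^(m x n) is identified with R^(m * n) through vec_mx. *)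
Definition lebesgue_mx m n : set 'M[R]_(m, n) -> \bar R :=
  pushforward (lebesgue_rV (m * n)) vec_mx.

End lebesgue_measure_matrix.

Section singular_values.
Context {R : rcfType}.

(* Real roots of the characteristic polynomial, repeated according to their
   algebraic multiplicity. For symmetric A these are all n eigenvalues. *)
Definition eigenvalues n (A : 'M[R]_n) : seq R :=
  flatten [seq nseq (mup x (char_poly A)) x | x <- rootsR (char_poly A)].

(* For n <= m, the square roots of the n eigenvalues of D D^T, in nonincreasing
   order. *)
Definition singular_values n m (D : 'M[R]_(n, m)) : seq R :=
  sort >=%R [seq Num.sqrt x | x <- eigenvalues (D *m D^T)].

(* The k-th largest singular value, with k counted from 1. *)
Definition sigma k n m (D : 'M[R]_(n, m)) : R := (singular_values D)`_k.-1.

Definition sigma_max n m (D : 'M[R]_(n, m)) : R := sigma 1 D.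

Definition spectral_ball n m : set 'M[R]_(n, m) := [set D | sigma_max D <= 1].

End singular_values.
Arguments spectral_ball {R} n m _.

(* The law of X is normalized Lebesgue measure on B. *)
Definition uniform_on d (Omega : measurableType d) (R : realType)
    (P : probability Omega R) n m (B : set 'M[R]_(n, m))
    (X : {RV P >-> 'M[R]_(n, m)}) : Prop :=
  forall A, measurable A ->
    (distribution P X A = lebesgue_mx (A `&` B) / lebesgue_mx B)%E.

(* Main.v *)
Require Import Defs.
From HB Require Import structures.
From mathcomp Require Import all_boot all_order all_algebra.
From mathcomp Require Import polyrcf complex spectral.
From mathcomp Require Import all_classical all_reals all_analysis.
From mathcomp Require Import measurable_realfun.
From mathcomp Require Import ring lra.

Set Implicit Arguments.
Unset Strict Implicit.
Unset Printing Implicit Defensive.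

Import Order.TTheory GRing.Theory Num.Theory.
Import numFieldNormedType.Exports.

Local Open Scope classical_set_scope.
Local Open Scope ring_scope.

(** Fix 0 <= r < 1.  The point is that the event sigma_n(Delta_m) <= r has a
    probability that decays geometrically in m, because the matrices it
    allows can be stretched without leaving the unit ball, and an n x n stretching L
    multiplies volumes in R^(n x m) by det(L)^m.

    In detail, D belongs to the unit spectral ball B iff D D^T <= 1 in the
    Loewner order.  If moreover sigma_n(D) <= r, then S = D D^T is an n x n
    matrix with 0 <= S <= 1 and one eigenvalue <= r^2, so det(S) <= r^2 < 1.
    All such S, whatever m is, lie in one bounded set of n x n matrices.
    Rounding the entries of S to a fine enough grid and adding a small multiple
    of the identity dominates S by one of finitely many positive definite
    matrices T with det(T) <= q^2 < 1.  Writing L T L^T = 1 with L triangular,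
    det(L) >= 1/q and (L D) (L D)^T = L S L^T <= L T L^T = 1, that is,
    L D is in B.  So a finite list of matrices L, depending only on n and r,
    is such that every D in B with sigma_n(D) <= r satisfies L D in B for some
    L in the list ([finite_cover]).

    The set {D | L D in B} has volume vol(B) / det(L)^m <= q^m vol(B)
    ([lebesgue_mx_mul]).  Under the uniform law the event sigma_n <= r
    therefore has probability at most N q^m, with N the length of the list.
    This is summable in m, and the first Borel-Cantelli lemma, valid for every
    joint law, shows that almost surely r < sigma_n(Delta_m) <= 1 for all
    large m ([ae_sigma_gt]).  Letting r run through 1 - 1/(k+1) gives the limit.

    Three facts support this.  The spectral theorem for real symmetric
    matrices is read off the unitary diagonalization over R[i]
    ([sym_spectrum]).  The change of variables is that of a triangular
    linear map, which follows from Fubini by induction on the dimension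
    ([lebesgue_rV_trig]).  And B is Borel since it is described by the signs
    of the coefficients of a characteristic polynomial ([ball_char_polyP]). *)

(** * Quadratic forms and the spectrum of symmetric matrices *)

Definition qform (R : pzRingType) n (A : 'M[R]_n) (v : 'rV[R]_n) : R :=
  (v *m A *m v^T) 0 0.

(** The Loewner order A <= B is expressed as [psd (B - A)]. *)
Definition psd (R : numDomainType) n (A : 'M[R]_n) : Prop :=
  forall v, 0 <= qform A v.

Lemma qformD (R : pzRingType) n (A B : 'M[R]_n) v :
  qform (A + B) v = qform A v + qform B v.
Proof. by rewrite /qform mulmxDr mulmxDl mxE. Qed.

Lemma qformN (R : pzRingType) n (A : 'M[R]_n) v : qform (- A) v = - qform A v.
Proof. by rewrite /qform mulmxN mulNmx mxE. Qed.

Lemma qformB (R : pzRingType) n (A B : 'M[R]_n) v :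
  qform (A - B) v = qform A v - qform B v.
Proof. by rewrite qformD qformN. Qed.

Lemma qform_scalar (R : comPzRingType) n (a : R) (v : 'rV[R]_n) :
  qform a%:M v = a * \sum_i v 0 i ^+ 2.
Proof.
rewrite /qform mul_mx_scalar -scalemxAl mxE mxE; congr (_ * _).
by apply: eq_bigr => i _; rewrite !mxE expr2.
Qed.

Lemma qform_congr (R : comPzRingType) n p (L : 'M[R]_(n, p)) (A : 'M[R]_p) v :
  qform (L *m A *m L^T) v = qform A (v *m L).
Proof. by rewrite /qform trmx_mul !mulmxA. Qed.

Lemma qform_gram (R : comPzRingType) n m (D : 'M[R]_(n, m)) v :
  qform (D *m D^T) v = \sum_j (v *m D) 0 j ^+ 2.
Proof. by rewrite -[D in D *m _]mulmx1 qform_congr qform_scalar mul1r. Qed.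

Lemma psd_gram (R : realDomainType) n m (D : 'M[R]_(n, m)) : psd (D *m D^T).
Proof. by move=> v; rewrite qform_gram sumr_ge0// => i _; rewrite sqr_ge0. Qed.

Lemma sum_sqr_gt0 (R : realDomainType) n (v : 'rV[R]_n) :
  v != 0 -> 0 < \sum_i v 0 i ^+ 2.
Proof.
move=> v0; rewrite lt_def sumr_ge0 ?andbT; last by move=> i _; rewrite sqr_ge0.
apply: contra v0; rewrite psumr_eq0; last by move=> i _; rewrite sqr_ge0.
move=> /allP H; apply/eqP/rowP => i; rewrite !mxE; apply/eqP.
by have := H i; rewrite mem_index_enum sqrf_eq0; apply.
Qed.

Lemma psd_root_ge0 (R : realFieldType) n (A : 'M[R]_n) x :
  psd A -> root (char_poly A) x -> 0 <= x.
Proof.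
rewrite -eigenvalue_root_char => pA /eigenvalueP[v vA v0].
have := pA v; rewrite /qform vA -[x *: v]mul_mx_scalar -/(qform _ v) qform_scalar.
by rewrite pmulr_lge0// sum_sqr_gt0.
Qed.

(** A and b A + a have the same eigenvectors. *)
Lemma root_char_poly_affine (F : fieldType) n (A : 'M[F]_n) (b a x : F) :
  b != 0 ->
  root (char_poly (b *: A + a%:M)) (b * x + a) = root (char_poly A) x.
Proof.
move=> b0; rewrite -!eigenvalue_root_char.
apply/eigenvalueP/eigenvalueP => -[v vA v0]; exists v => //.
  move: vA; rewrite mulmxDr mul_mx_scalar scalerDl => /addIr.
  by rewrite -scalemxAr -scalerA => /(scalerI b0).
by rewrite mulmxDr mul_mx_scalar -scalemxAr vA scalerA scalerDl.
Qed.

Lemma char_poly_similar (F : fieldType) n (P A : 'M[F]_n) : P \in unitmx ->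
  char_poly (invmx P *m A *m P) = char_poly A.
Proof.
move=> uP; rewrite /char_poly /char_poly_mx !map_mxM.
have PP : map_mx polyC (invmx P) *m map_mx polyC P = 1%:M.
  by rewrite -map_mxM mulVmx// map_mx1.
rewrite (_ : 'X%:M - _ = map_mx polyC (invmx P) *m ('X%:M - map_mx polyC A) *m map_mx polyC P).
  rewrite !det_mulmx mulrC mulrA -det_mulmx.
  by rewrite -map_mxM mulmxV// map_mx1 det1 mul1r.
by rewrite mulmxBr mulmxBl; congr (_ - _); rewrite mul_mx_scalar -scalemxAl PP scalemx1.
Qed.

(** A real symmetric matrix is Hermitian over R[i], so it is U^* diag(d) U with
    U unitary and d real.  With u = v U^*, the quadratic form at v is the sum
    of the d_i |u_i|^2, whose weights are real and nonnegative.  Stating the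
    result through these weights keeps complex matrices out of what follows. *)
Lemma sym_spectrum (R : rcfType) n (A : 'M[R]_n) : A^T = A ->
  exists2 d : 'rV[R]_n, char_poly A = \prod_i ('X - (d 0 i)%:P) &
    forall v, exists2 w : 'I_n -> R, (forall i, 0 <= w i) &
      qform A v = \sum_i d 0 i * w i.
Proof.
move=> Asym; pose c := (real_complex R : {rmorphism R -> R[i]}).
pose B := map_mx c A.
have cconj (x : R) : (c x)^* = c x by exact: conjc_real.
have Bherm : B \is hermsymmx.
  apply/is_hermitianmxP; rewrite expr0 scale1r; apply/matrixP => i j.
  by rewrite !mxE cconj -[in LHS]Asym mxE.
have Bspec := orthomx_spectralP (hermitian_normalmx Bherm).
set P := spectralmx B in Bspec; set s := spectral_diag B in Bspec.
have uP : P \in unitmx by exact: spectral_unit.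
pose d : 'rV[R]_n := \row_i complex.Re (s 0 i).
have sE i : s 0 i = c (d 0 i).
  rewrite mxE; have /mxOverP/(_ 0 i) := hermitian_spectral_diag_real Bherm.
  by rewrite -/s => /complex_realP[k ->].
exists d.
  apply: (map_poly_inj c); rewrite map_char_poly -/B Bspec char_poly_similar//.
  rewrite char_poly_trig ?diag_mx_is_trig// rmorph_prod/=.
  by apply: eq_bigr => i _; rewrite mxE eqxx mulr1n sE rmorphB/= map_polyX map_polyC.
move=> v; pose u := map_mx c v *m invmx P.
exists (fun i => complex.Re (u 0 i * (u 0 i)^* )).
  by move=> i; have := mul_conjC_ge0 (u 0 i); case: (_ * _) => a b /=; rewrite lecE => /andP[].
apply: (fmorph_inj c); rewrite rmorph_sum/=.
have -> : c (qform A v) = (map_mx c v *m B *m (map_mx c v)^T) 0 0.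
  by rewrite /qform map_trmx -!map_mxM [RHS]mxE.
rewrite [X in _ *m X *m _]Bspec -!mulmxA (mulmxA _ (invmx P)) -/u.
have -> : P *m (map_mx c v)^T = map_mx Num.conj u^T.
  rewrite /u trmx_mul map_mxM/= (invmx_unitary (spectral_unitarymx B)) -/P.
  rewrite trmxCK; congr (_ *m _).
  by apply/matrixP => i j; rewrite !mxE cconj.
clearbody u; rewrite mulmxA mxE; apply: eq_bigr => i _.
rewrite mul_mx_diag !mxE sE rmorphM/= mulrAC mulrC; congr (_ * _).
have : u 0 i * (u 0 i)^* \is Num.real by rewrite ger0_real// mul_conjC_ge0.
by move=> /complex_realP[k ->].
Qed.

Lemma root_char_poly_sub_scalar (F : fieldType) n (A : 'M[F]_n) (a x : F) :
  root (char_poly (a%:M - A)) (a - x) = root (char_poly A) x.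
Proof.
rewrite -(@root_char_poly_affine _ _ A (-1) a x) ?oppr_eq0 ?oner_eq0//.
by rewrite scaleN1r mulN1r addrC [- x + a]addrC.
Qed.

Lemma char_poly_rootP (R : idomainType) n (A : 'M[R]_n) (d : 'rV[R]_n) x :
  char_poly A = \prod_i ('X - (d 0 i)%:P) ->
  reflect (exists i, x = d 0 i) (root (char_poly A) x).
Proof.
move=> ->; rewrite /root horner_prod prodf_seq_eq0.
apply: (iffP hasP) => [[i _ /=]|[i ->]].
  by rewrite hornerXsubC subr_eq0 => /eqP ->; exists i.
by exists i; rewrite ?mem_index_enum// hornerXsubC subrr eqxx.
Qed.

Lemma det_char_poly_prod (R : comNzRingType) n (A : 'M[R]_n) (d : 'rV[R]_n) :
  char_poly A = \prod_i ('X - (d 0 i)%:P) -> \det A = \prod_i d 0 i.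
Proof.
move=> Ad; have := char_poly_det A; rewrite Ad -horner_coef0 horner_prod.
under eq_bigr do rewrite hornerXsubC sub0r -mulN1r.
rewrite big_split/= prodr_const card_ord => /(congr1 ( *%R ((-1) ^+ n))).
by rewrite !mulrA -exprD -signr_odd oddD addbb !mul1r => <-.
Qed.

Lemma psd_of_root_ge0 (R : rcfType) n (A : 'M[R]_n) : A^T = A ->
  (forall x, root (char_poly A) x -> 0 <= x) -> psd A.
Proof.
move=> /sym_spectrum[d Ad qA] A0 v; have [w w0 ->] := qA v.
apply: sumr_ge0 => i _; rewrite mulr_ge0//; apply: A0.
by apply/(char_poly_rootP _ Ad); exists i.
Qed.

Lemma psd_root_le (R : realFieldType) n (A : 'M[R]_n) a x :
  psd (a%:M - A) -> root (char_poly A) x -> x <= a.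
Proof. by rewrite -(root_char_poly_sub_scalar _ a) -subr_ge0 => /psd_root_ge0; apply. Qed.

Lemma det_ge1 (R : rcfType) n (A : 'M[R]_n) : A^T = A -> psd (A - 1%:M) ->
  1 <= \det A.
Proof.
move=> /sym_spectrum[d Ad _] pA; rewrite (det_char_poly_prod Ad).
apply: (big_ind (fun x => 1 <= x)) => //.
  by move=> x y x1 y1; rewrite -[1]mulr1 ler_pM.
move=> i _; rewrite -subr_ge0; apply: (psd_root_ge0 pA).
rewrite -[d 0 i]mul1r -[A]scale1r -[- 1%:M]raddfN/=.
rewrite root_char_poly_affine ?oner_eq0//.
by apply/(char_poly_rootP _ Ad); exists i.
Qed.

(** All eigenvalues lie in [0, a] and one of them is x. *)
Lemma det_le (R : rcfType) n (A : 'M[R]_n) a x : A^T = A -> psd A ->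
  psd (a%:M - A) -> root (char_poly A) x -> \det A <= a ^+ n.-1 * x.
Proof.
move=> /sym_spectrum[d Ad _] pA paA rx; rewrite (det_char_poly_prod Ad).
have dr j : root (char_poly A) (d 0 j).
  by apply/(char_poly_rootP _ Ad); exists j.
have /(char_poly_rootP _ Ad)[i xi] := rx.
rewrite (bigD1 i)//= mulrC xi ler_wpM2r// ?(psd_root_ge0 pA)//.
rewrite -[n in n.-1]card_ord -(cardC1 i) -prodr_const.
apply: ler_prod => j _.
by rewrite (psd_root_ge0 pA)//= (psd_root_le paA).
Qed.

(** [eigenvalues] lists the distinct real roots with their multiplicities, so
    for a split characteristic polynomial it recovers all of its roots. *)
Lemma perm_eigenvalues (R : rcfType) n (A : 'M[R]_n) (d : 'rV[R]_n) :
  char_poly A = \prod_i ('X - (d 0 i)%:P) ->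
  perm_eq (eigenvalues A) [seq d 0 i | i <- enum 'I_n].
Proof.
move=> Ad; have p0 : char_poly A != 0 by rewrite monic_neq0// char_poly_monic.
apply/allP => x _ /=; apply/eqP.
rewrite /eigenvalues count_flatten -map_comp /=.
have -> : [seq (count_mem x \o (fun y => nseq (mup y (char_poly A)) y)) y
            | y <- rootsR (char_poly A)] =
          [seq (x == y) * mup x (char_poly A) | y <- rootsR (char_poly A)]%N.
  by apply: eq_map => y /=; rewrite count_nseq /= eq_sym; case: eqVneq => // ->.
rewrite sumnE big_map -big_distrl/=.
have -> : mup x (char_poly A) = count_mem x [seq d 0 i | i <- enum 'I_n].
  by rewrite Ad -mu_prod_XsubC big_map big_enum.
have -> : (\sum_(y <- rootsR (char_poly A)) (x == y) =
           (x \in rootsR (char_poly A)))%N.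
  rewrite -(count_uniq_mem x (uniq_roots _ _ _)) -sum1_count [RHS]big_mkcond/=.
  by apply: eq_bigr => y _; rewrite eq_sym; case: eqP.
have /= <- := roots_on_rootsR p0 x.
case: (boolP (root _ _)) => [_|]; first by rewrite mul1n.
rewrite mul0n => /(char_poly_rootP _ Ad) nx; apply/esym/count_memPn.
by apply/mapP => -[i _ xi]; apply: nx; exists i.
Qed.

Lemma size_eigenvalues (R : rcfType) n (A : 'M[R]_n) : A^T = A ->
  size (eigenvalues A) = n.
Proof.
move=> /sym_spectrum[d Ad _].
by rewrite (perm_size (perm_eigenvalues Ad)) size_map size_enum_ord.
Qed.

Lemma mem_eigenvalues (R : rcfType) n (A : 'M[R]_n) x : A^T = A ->
  (x \in eigenvalues A) = root (char_poly A) x.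
Proof.
move=> /sym_spectrum[d Ad _]; rewrite (perm_mem (perm_eigenvalues Ad)).
apply/mapP/(char_poly_rootP _ Ad) => [[i _ ->]|[i ->]]; exists i => //.
by rewrite mem_enum.
Qed.

(** * Singular values and the spectral ball *)

Lemma tr_gram (R : comPzRingType) n m (D : 'M[R]_(n, m)) :
  (D *m D^T)^T = D *m D^T.
Proof. by rewrite trmx_mul trmxK. Qed.

Lemma size_singular_values (R : rcfType) n m (D : 'M[R]_(n, m)) :
  size (singular_values D) = n.
Proof. by rewrite size_sort size_map size_eigenvalues// tr_gram. Qed.

Lemma singular_valuesP (R : rcfType) n m (D : 'M[R]_(n, m)) s :
  reflect (exists2 x, root (char_poly (D *m D^T)) x & s = Num.sqrt x)
    (s \in singular_values D).
Proof.
rewrite mem_sort; apply: (iffP mapP) => -[x xr ->]; exists x => //.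
  by rewrite -mem_eigenvalues// tr_gram.
by rewrite mem_eigenvalues// tr_gram.
Qed.

Lemma sigma_maxP (R : rcfType) n m (D : 'M[R]_(n, m)) :
  spectral_ball n m D <-> forall s, s \in singular_values D -> s <= 1.
Proof.
rewrite /spectral_ball /= /sigma_max /sigma /=.
have srt : sorted >=%R (singular_values D).
  by apply: sort_sorted => x y; exact: le_total.
split=> [|]; last first.
  case: (singular_values D) => [_|x s H] /=; first exact: ler01.
  by apply: H; rewrite mem_head.
case: (singular_values D) srt => [//|x s] /= srt x1 y.
rewrite inE => /predU1P[->//|ys]; apply: le_trans x1.
by have /allP/(_ y ys) := order_path_min (rev_trans le_trans) srt.
Qed.

(** This turns the spectral ball into a linear matrix inequality, the form in
    which it is compatible with left multiplication of D. *)
Lemma spectral_ballP (R : rcfType) n m (D : 'M[R]_(n, m)) :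
  spectral_ball n m D <-> psd (1%:M - D *m D^T).
Proof.
rewrite sigma_maxP; split=> [D1|pD _ /singular_valuesP[x rx ->]].
  apply: psd_of_root_ge0; first by rewrite linearB/= trmx1 tr_gram.
  move=> x rx; have := rx.
  rewrite -[x](subKr 1) root_char_poly_sub_scalar subr_ge0.
  move: (1 - x) => {rx}y ry; rewrite -(ler_sqrt _ ler01) sqrtr1.
  by apply: D1; apply/singular_valuesP; exists y.
by rewrite -[leRHS]sqrtr1 ler_sqrt// (psd_root_le pD).
Qed.

Lemma sigma_ball (R : rcfType) n m (D : 'M[R]_(n, m)) : (0 < n)%N ->
  spectral_ball n m D -> exists x,
    [/\ 0 <= x <= 1, root (char_poly (D *m D^T)) x & sigma n D = Num.sqrt x].
Proof.
move=> n0 bD.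
have /singular_valuesP[x rx sx] : sigma n D \in singular_values D.
  by rewrite mem_nth// size_singular_values prednK.
exists x; split => //; rewrite (psd_root_ge0 (psd_gram D) rx)/=.
by move/spectral_ballP/psd_root_le : bD; apply.
Qed.

(** * Cholesky factorization *)

(** Inverse Cholesky factorization.  It proceeds by induction on the trailing
    principal submatrix C = drsubmx A, so that L comes out upper triangular:
    this is the shape for which D |-> L D acts on the row-major entries of D
    by a lower triangular matrix in [lebesgue_mx_mul]. *)
Lemma cholesky_inv (R : rcfType) n (A : 'M[R]_n) : A^T = A ->
    (forall v, v != 0 -> 0 < qform A v) ->
  exists L : 'M[R]_n,
    [/\ is_trig_mx L^T, forall i, 0 < L i i & L *m A *m L^T = 1%:M].
Proof.
elim: n A => [|n IH] A Asym Apos.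
  by exists 0; rewrite trmx0; split=> [||];
    [exact: mx0_is_trig|case|apply/matrixP => -[]].
change 'M[R]_(1 + n) in A.
change (exists L : 'M[R]_(1 + n),
  [/\ is_trig_mx L^T, forall i, 0 < L i i & L *m A *m L^T = 1%:M]).
have {}Apos (v : 'rV_(1 + n)) : v != 0 -> 0 < (v *m A *m v^T) 0 0 := Apos v.
pose b := ursubmx A; pose C := drsubmx A; pose a := ulsubmx A.
have bT : dlsubmx A = b^T by rewrite /b trmx_ursub Asym.
have CT : C^T = C by rewrite /C trmx_drsub Asym.
have AE : A = block_mx a b b^T C by rewrite -bT /a /b /C submxK.
have [w w0|L [Ltrig Lpos LC]] := IH C CT.
  have := Apos (row_mx 0 w); rewrite AE mul_row_block tr_row_mx mul_row_col.
  rewrite trmx0 mulmx0 !mul0mx !add0r; apply.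
  apply: contra w0 => /eqP v0; apply/eqP/rowP => i.
  by move/matrixP: v0 => /(_ 0 (rshift 1 i)); rewrite row_mxEr !mxE.
have MC : L^T *m L *m C = 1%:M.
  by rewrite -mulmxA; apply: mulmx1C.
(* (1, u) is A-orthogonal to the trailing coordinates; its A-norm is the
   Schur complement of C, which has to be normalized to 1. *)
pose u := - (b *m (L^T *m L)).
have buC : b + u *m C = 0 by rewrite mulNmx -mulmxA MC mulmx1 subrr.
have CbT : b^T + C *m u^T = 0 by rewrite -[C]CT -trmx_mul -linearD/= buC trmx0.
pose sig := (a + u *m b^T) 0 0.
have sigE : a + u *m b^T = sig%:M by rewrite [LHS]mx11_scalar.
have sig0 : 0 < sig.
  have := Apos (row_mx 1%:M u); rewrite AE mul_row_block tr_row_mx mul_row_col.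
  rewrite !mul1mx buC mul0mx addr0 trmx1 mulmx1; apply.
  apply/eqP => /matrixP/(_ 0 (lshift n 0)).
  by rewrite row_mxEl !mxE eqxx => /eqP; rewrite oner_eq0.
pose s := (Num.sqrt sig)^-1.
exists (block_mx s%:M (s *: u) 0 L : 'M[R]_(1 + n)); split.
- rewrite tr_block_mx trmx0 tr_scalar_mx.
  by rewrite is_trig_block_mx// eqxx scalar_mx_is_trig.
- move=> i; case: (splitP i) => j ij.
    rewrite (_ : i = lshift n j); last exact: val_inj.
    by rewrite block_mxEul mxE (ord1 j) eqxx mulr1n invr_gt0 sqrtr_gt0.
  rewrite (_ : i = rshift 1 j); last exact: val_inj.
  by rewrite block_mxEdr.
- rewrite AE mulmx_block tr_block_mx mulmx_block !trmx0 tr_scalar_mx.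
  have -> : s%:M *m a + s *: u *m b^T = (s * sig)%:M.
    by rewrite mul_scalar_mx -scalemxAl -scalerDr sigE scale_scalar_mx.
  have -> : s%:M *m b + s *: u *m C = 0.
    by rewrite mul_scalar_mx -scalemxAl -scalerDr buC scaler0.
  rewrite !mul0mx !mulmx0 !addr0 !add0r LC -scalar_mxM.
  have -> : L *m b^T *m s%:M + L *m C *m (s *: u)^T = 0.
    rewrite linearZ/= -scalemxAr mul_mx_scalar -scalerDr -!mulmxA -mulmxDr.
    by rewrite CbT mulmx0 scaler0.
  have -> : s * sig * s = 1.
    by rewrite mulrAC -expr2 exprVn sqr_sqrtr ?mulVf ?gt_eqF// ltW.
  by rewrite -scalar_mx_block.
Qed.

(** * A finite cover of the matrices with a small eigenvalue *)

(** If L A L^T = 1, then L B L^T >= 1 has determinant at least 1. *)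
Lemma det_le_psd (R : rcfType) n (A B : 'M[R]_n) : A^T = A -> B^T = B ->
  (forall v, v != 0 -> 0 < qform A v) -> psd (B - A) -> \det A <= \det B.
Proof.
move=> AT BT Apos pBA; have [L [Ltrig Lpos LA]] := cholesky_inv AT Apos.
have LBT : (L *m B *m L^T)^T = L *m B *m L^T by rewrite !trmx_mul trmxK BT mulmxA.
have : 1 <= \det (L *m B *m L^T).
  apply: det_ge1 => // v; rewrite -LA -mulmxBl -mulmxBr qform_congr.
  exact: pBA.
rewrite -(det1 R n) -LA !det_mulmx det_tr mulrAC [leRHS]mulrAC.
rewrite ler_pM2l// -expr2 exprn_gt0// -det_tr det_trig//.
by apply: prodr_gt0 => i _; rewrite mxE.
Qed.

Lemma mul_delta_mx_tr (R : pzRingType) n (A : 'M[R]_n) i j :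
  (delta_mx 0 i : 'rV_n) *m A *m (delta_mx 0 j : 'rV_n)^T = (A i j)%:M.
Proof. by rewrite [LHS]mx11_scalar -rowE trmx_delta -colE !mxE. Qed.

(** Positivity of the form at e_i + e_j and e_i - e_j bounds the entry by the
    diagonal ones. *)
Lemma psd_entry_le (R : realFieldType) n (A : 'M[R]_n) i j : A^T = A ->
  psd A -> psd (1%:M - A) -> `|A i j| <= 1.
Proof.
move=> AT pA p1A.
have diag k : A k k <= 1.
  have := p1A (delta_mx 0 k); rewrite qformB /qform !mul_delta_mx_tr !mxE !eqxx.
  by rewrite !mulr1n subr_ge0.
have Aji : A j i = A i j by rewrite -{1}AT mxE.
have polar (s : R) : 0 <= A i i + s * A i j + (s * A i j + s ^+ 2 * A j j).
  have := pA (delta_mx 0 i + s *: delta_mx 0 j).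
  rewrite /qform linearD linearZ/= mulmxDl mulmxDr !mulmxDl -!scalemxAl.
  rewrite -!scalemxAr !scalerA.
  by rewrite !mul_delta_mx_tr !mxE !eqxx !mulr1n Aji.
have := polar 1; have := polar (-1); have := diag i; have := diag j.
rewrite ler_norml sqrrN expr1n !mulN1r !mul1r; lra.
Qed.

(** By the arithmetic-geometric inequality, each |v_i v_j| is at most
    (v_i^2 + v_j^2) / 2. *)
Lemma psd_entrywise (R : realFieldType) n (E : 'M[R]_n) (e : R) :
  (forall i j, `|E i j| <= e) -> psd ((n%:R * e)%:M - E).
Proof.
move=> Ee v; rewrite qformB subr_ge0 qform_scalar.
have -> : qform E v = \sum_i \sum_j v 0 i * E i j * v 0 j.
  rewrite /qform mxE exchange_big/=; apply: eq_bigr => j _.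
  by rewrite mxE mulr_suml; apply: eq_bigr => i _; rewrite mxE.
have bnd i j : v 0 i * E i j * v 0 j <= e * (v 0 i ^+ 2 + v 0 j ^+ 2) / 2.
  rewrite (le_trans (ler_norm _))// !normrM mulrAC.
  have e0 : 0 <= e by exact: le_trans (Ee i j).
  rewrite (@le_trans _ _ (`|v 0 i| * `|v 0 j| * e))// ?ler_wpM2l ?mulr_ge0//.
  rewrite mulrC -mulrA ler_wpM2l//.
  rewrite -(real_normK (num_real (v 0 i))) -(real_normK (num_real (v 0 j))).
  have := sqr_ge0 (`|v 0 i| - `|v 0 j|); rewrite sqrrB; lra.
apply: (le_trans (ler_sum _ (fun i _ => ler_sum _ (fun j _ => bnd i j)))).
under eq_bigr do rewrite -mulr_suml -mulr_sumr big_split/= sumr_const card_ord.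
rewrite -mulr_suml -mulr_sumr big_split/= sumr_const card_ord sumrMnl.
rewrite le_eqVlt; apply/orP; left; apply/eqP.
rewrite -[X in X + _]mulr_natl -[X in _ + X]mulr_natl.
by field.
Qed.

Lemma grid_approx (R : archiRealFieldType) (k : nat) (x : R) : `|x| <= 1 ->
  exists t : 'I_(k.+1).*2.+1, `|x - (t%:R / k.+1%:R - 1)| <= k.+1%:R^-1.
Proof.
rewrite ler_norml => /andP[xlo xhi].
have k0 : 0 < k.+1%:R :> R by rewrite ltr0n.
have y0 : 0 <= (x + 1) * k.+1%:R by rewrite mulr_ge0// -lerBlDr sub0r.
have /andP[tlo thi] := truncn_itv y0; set t := Num.truncn _ in tlo thi.
have tb : (t < (k.+1).*2.+1)%N.
  rewrite ltnS -(ler_nat R) (le_trans tlo)// -muln2 natrM mulrC ler_wpM2l//.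
  lra.
exists (Ordinal tb) => /=; move: tlo thi.
rewrite -ler_pdivrMr// -ltr_pdivlMr// -(natr1 t) mulrDl mul1r ler_norml => tlo thi.
have ki : 0 < k.+1%:R^-1 :> R by rewrite invr_gt0.
move: (k.+1%:R^-1) (t%:R / k.+1%:R) tlo thi ki => h u *.
by apply/andP; split; lra.
Qed.

(** The expression is the bound that [det_le] gives for S + c, when S <= 1 has
    an eigenvalue at most r and c is three times the error n / (k + 1) that
    rounding to a grid of step 1 / (k + 1) causes in the Loewner order. *)
Lemma small_grid (R : realType) (m n : nat) (r : R) : r < 1 ->
  exists k : nat, let c := n%:R / k.+1%:R *+ 3 in (1 + c) ^+ m * (r + c) < 1.
Proof.
move=> r1; pose p : {poly R} := (1 + 'X) ^+ m * (r%:P + 'X).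
have pE x : p.[x] = (1 + x) ^+ m * (r + x) by rewrite !hornerE.
pose c (k : nat) : R := n%:R / k.+1%:R *+ 3.
have c0 : c @ \oo --> (0 : R).
  rewrite -[0](mul0rn _ 3) -(mulr0 n%:R); apply: cvgMn.
  by apply: cvgMl_tmp; exact: cvg_harmonic.
have pc : p.[c k] @[k --> \oo] --> p.[0].
  by apply: continuous_cvg => //; exact: continuous_horner.
have p01 : p.[0] < 1 by rewrite pE !addr0 expr1n mul1r.
have [k _ /(_ k (leqnn k))] := cvgr_lt _ pc _ p01.
by rewrite pE; exists k.
Qed.

(** The covering is uniform over all S, hence over all widths m of the matrices
    D with S = D D^T.  Each S is rounded to a grid matrix G with
    -e <= S - G <= e; then T = G + 2e satisfies S + e <= T <= S + 3e.  The
    left inequality makes T positive definite and larger than S, the right one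
    keeps det T <= p < 1.  The cover consists of the L with L T L^T = 1, for the
    finitely many grid matrices that behave well. *)
Lemma finite_cover (R : realType) (n : nat) (r : R) : (0 < n)%N -> 0 <= r < 1 ->
  exists2 q : R, 0 < q < 1 & exists s : seq 'M[R]_n,
    (forall L, L \in s ->
       [/\ is_trig_mx L^T, forall i, 0 < L i i & 1 <= q * \det L]) /\
    (forall S : 'M[R]_n, S^T = S -> psd S -> psd (1%:M - S) ->
       (exists2 x, root (char_poly S) x & x <= r) ->
       exists2 L, L \in s & psd (1%:M - L *m S *m L^T)).
Proof.
move=> n0 /andP[r0 r1]; have [k] := small_grid n.-1 n r1; cbv zeta.
set e := _ / _; set p : R := _ * _ => p1.
have e_gt0 : 0 < e by rewrite divr_gt0 ?ltr0n.
have e0 := ltW e_gt0.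
have p0 : 0 < p.
  by rewrite mulr_gt0 ?exprn_gt0 ?ltr_wpDl ?ltr_pwDl ?mulrn_wgt0 ?mulrn_wge0.
exists (Num.sqrt p).
  by rewrite sqrtr_gt0 p0/= -sqrtr1 ltr_sqrt.
pose N := k.+1.*2.+1.
pose T (t : 'M['I_N]_n) : 'M[R]_n :=
  \matrix_(i, j) ((t i j)%:R / k.+1%:R - 1) + (e *+ 2)%:M.
pose good (t : 'M['I_N]_n) :=
  [/\ (T t)^T = T t, forall v, v != 0 -> 0 < qform (T t) v & \det (T t) <= p].
have /choice[L HL] (t : 'M['I_N]_n) : exists L : 'M[R]_n, good t ->
    [/\ is_trig_mx L^T, forall i, 0 < L i i & L *m T t *m L^T = 1%:M].
  have [g|ng] := pselect (good t); last by exists 0.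
  by case: g => g1 g2 _; have [L HL] := cholesky_inv g1 g2; exists L.
exists [seq L t | t <- enum {: 'M['I_N]_n} & `[< good t >]]; split.
  move=> M /mapP[t]; rewrite mem_filter => /andP[/asboolP gt _ ->].
  have [trigL posL LT] := HL t gt; split=> //.
  have dL : 0 < \det (L t) by rewrite -det_tr det_trig// prodr_gt0// => i _; rewrite mxE.
  have [_ _ dT] := gt.
  have LT1 : \det (L t) ^+ 2 * \det (T t) = 1.
    by rewrite expr2 -(det1 R n) -LT !det_mulmx det_tr [RHS]mulrAC.
  rewrite -[1]sqrtr1 -[\det _]gtr0_norm// -sqrtr_sqr -sqrtrM ?(ltW p0)// ler_wsqrtr//.
  by rewrite mulrC -LT1 ler_wpM2l// exprn_ge0// ltW.
move=> S ST pS p1S [x rx xr].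
have /choice[f Hf] (y : R) : exists t : 'I_N, `|y| <= 1 ->
    `|y - (t%:R / k.+1%:R - 1)| <= k.+1%:R^-1.
  have [/(grid_approx k)[t Ht]|y1] := pselect (`|y| <= 1); first by exists t.
  by exists ord0.
(* Rounding depends on the value of the entry only, so that G is symmetric. *)
pose t : 'M['I_N]_n := \matrix_(i, j) f (S i j).
pose G := T t - (e *+ 2)%:M.
have GE i j : G i j = (f (S i j))%:R / k.+1%:R - 1.
  by rewrite /G /T addrK !mxE.
have TE : T t = G + (e *+ 2)%:M by rewrite /G subrK.
clearbody G.
have SG i j : `|S i j - G i j| <= k.+1%:R^-1.
  by rewrite GE; apply: Hf; exact: psd_entry_le.
have lo : psd (e%:M - (S - G)) by apply: psd_entrywise => i j; rewrite !mxE; exact: SG.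
have hi : psd (e%:M - (G - S)).
  by apply: psd_entrywise => i j; rewrite !mxE distrC; exact: SG.
have TT : (T t)^T = T t.
  rewrite TE linearD/= tr_scalar_mx; congr (_ + _); apply/matrixP => i j.
  by rewrite mxE !GE -{1}ST mxE.
have Tpos v : v != 0 -> 0 < qform (T t) v.
  move=> v0; have := lo v; have := pS v.
  have : 0 < e * \sum_i v 0 i ^+ 2 by rewrite mulr_gt0 ?sum_sqr_gt0.
  rewrite TE !(qformD, qformN) !qform_scalar mulrnAl; lra.
have hiT : psd (S + (e *+ 3)%:M - T t).
  move=> v; have := hi v.
  rewrite TE !(qformD, qformN) !qform_scalar !mulrnAl; lra.
have ScT : (S + (e *+ 3)%:M)^T = S + (e *+ 3)%:M.
  by rewrite linearD/= ST tr_scalar_mx.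
have gt : good t.
  split => //; apply: (le_trans (det_le_psd TT ScT Tpos hiT)).
  have rx3 : root (char_poly (S + (e *+ 3)%:M)) (x + e *+ 3).
    by rewrite -[S]scale1r -[x]mul1r root_char_poly_affine ?oner_eq0.
  have pS3 : psd (S + (e *+ 3)%:M).
    move=> v; rewrite qformD addr_ge0// qform_scalar mulr_ge0 ?mulrn_wge0//.
    by apply: sumr_ge0 => i _; rewrite sqr_ge0.
  have p1S3 : psd ((1 + e *+ 3)%:M - (S + (e *+ 3)%:M)).
    by rewrite [(1 + _)%:M]raddfD opprD addrACA subrr addr0.
  apply: (le_trans (det_le ScT pS3 p1S3 rx3)).
  by rewrite ler_wpM2l ?exprn_ge0 ?addr_ge0 ?mulrn_wge0// lerD2r.
have [_ _ LT] := HL t gt; exists (L t).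
  by apply/mapP; exists t => //; rewrite mem_filter mem_enum andbT; apply/asboolP.
move=> v; rewrite -LT -mulmxBl -mulmxBr qform_congr.
move: (v *m L t) => {}v; have := lo v.
have : 0 <= e * \sum_i v 0 i ^+ 2.
  by rewrite mulr_ge0//; apply: sumr_ge0 => i _; rewrite sqr_ge0.
rewrite TE !(qformD, qformN) !qform_scalar !mulrnAl; lra.
Qed.

(** * Lebesgue measure under triangular linear maps *)

Lemma lebesgue_measure_affine (R : realType) (s b : R) (A : set R) : 0 < s ->
  measurable A ->
  (s%:E * lebesgue_measure [set x : R | A (s * x + b)%R] = lebesgue_measure A)%E.
Proof.
move=> s0 mA.
pose f0 : measurableTypeR R -> measurableTypeR R := fun x => s * x + b.
have mf : measurable_fun setT f0.
  by apply: measurable_funD => //; exact: measurable_funM.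
pose mu := mscale (NngNum (ltW s0)) (pushforward (@lebesgue_measure R) f0).
rewrite -[LHS]/(mu mf A); apply/esym/lebesgue_measure_unique => // _ [[x y] _ <-].
transitivity (s%:E * @lebesgue_measure R (f0 @^-1` [set` `]x, y]]))%E; last by [].
rewrite (_ : f0 @^-1` _ = `](x - b) / s, (y - b) / s]%classic); last first.
  apply/seteqP; split => z /=; rewrite !in_itv/= ltr_pdivrMr// ler_pdivlMr//;
    by rewrite ltrBlDr lerBrDr mulrC.
rewrite !lebesgue_measure_itv/= !lte_fin ltr_pM2r ?invr_gt0// ltrD2r.
case: ifPn => xy; last by rewrite mule0.
rewrite -!EFinB -EFinM; congr EFin; field; exact: lt0r_neq0.
Qed.

Lemma measurable_mulmxr (R : realType) n (G : 'M[R]_n) :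
  measurable_fun setT (fun v : 'rV[R]_n => v *m G).
Proof.
apply/measurable_fun_mxP => i j; under eq_fun do rewrite mxE.
by apply: measurable_sum => k; apply: measurable_funM => //;
  exact: measurable_mx_entry.
Qed.

Lemma row_cons_mul (R : realType) n (p : 'rV[R]_n * R) (G : 'M[R]_(1 + n)) :
  ursubmx G = 0 ->
  row_cons p *m G = row_cons (p.1 *m drsubmx G,
    ulsubmx G 0 0 * p.2 + (p.1 *m dlsubmx G) 0 0).
Proof.
move=> G0; rewrite -[in LHS](submxK G).
change ((row_mx (p.2%:M : 'rV_1) p.1 : 'rV_(1 + n)) *m
    block_mx (ulsubmx G) (ursubmx G) (dlsubmx G) (drsubmx G) =
  row_mx (ulsubmx G 0 0 * p.2 + (p.1 *m dlsubmx G) 0 0)%:M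
    (p.1 *m drsubmx G)).
rewrite mul_row_block G0 mulmx0 add0r; congr (row_mx _ _).
rewrite [LHS]mx11_scalar; congr (_%:M).
by rewrite mxE mul_scalar_mx mxE mulrC.
Qed.

Lemma xsection_row_cons (R : realType) n (A : set 'rV[R]_n.+1) p :
  xsection (@row_cons R n @^-1` A) p = [set x | A (row_cons (p, x))].
Proof. by apply/seteqP; split=> x /=; rewrite /xsection/= inE. Qed.

Lemma measurable_preimage_row_cons (R : realType) n (A : set 'rV[R]_n.+1) :
  measurable A -> measurable (@row_cons R n @^-1` A).
Proof.
by move=> mA; rewrite -[X in measurable X]setTI; exact: measurable_row_cons.
Qed.

Lemma measurable_fun_row_cons_section (R : realType) n (A : set 'rV[R]_n.+1) :
  measurable A ->
  measurable_fun setT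
    (fun p => @lebesgue_measure R [set x | A (row_cons (p, x))]).
Proof.
move=> mA; under eq_fun do rewrite -xsection_row_cons.
by apply: measurable_fun_xsection; exact: measurable_preimage_row_cons.
Qed.

(** The new coordinate is the inner variable of the iterated integral. *)
Lemma lebesgue_rVS (R : realType) n (A : set 'rV[R]_n.+1) :
  lebesgue_rV n.+1 A =
  (\int[lebesgue_rV n]_p (@lebesgue_measure R [set x | A (row_cons (p, x))]))%E.
Proof.
rewrite /= /lebesgue_cons /pushforward /product_measure1.
by apply: eq_integral => p _ /=; rewrite xsection_row_cons.
Qed.

(** As G is lower triangular, for v = row_cons (p, x) the trailing coordinates
    of v G depend on p only, and its head is an affine function of x whose
    shift depends on p.  For each fixed p the inner integral over x is thus
    handled by the one-dimensional case; the outer one is a pushforward under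
    a lower triangular matrix of smaller size, handled by induction. *)
Lemma lebesgue_rV_trig (R : realType) n (G : 'M[R]_n) (A : set 'rV[R]_n) :
  is_trig_mx G -> (forall i, 0 < G i i) -> measurable A ->
  ((\prod_i G i i)%:E * lebesgue_rV n [set v | A (v *m G)] =
    lebesgue_rV n A)%E.
Proof.
elim: n G A => [|n IH] G A Gtrig Gpos mA.
  rewrite big_ord0 mul1e; congr (lebesgue_rV _ _); apply/seteqP.
  by split=> v /=; rewrite [_ *m _]thinmx0 [v]thinmx0.
change 'M[R]_(1 + n) in G.
pose s := G ord0 ord0; pose g := dlsubmx G; pose G' := drsubmx G.
have sE : ulsubmx G 0 0 = s by rewrite !mxE; congr (G _ _); exact: val_inj.
have Gur : ursubmx G = 0 by exact: (ursubmx_trig (leqnn 1) Gtrig).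
have G'trig : is_trig_mx G' by exact: (drsubmx_trig (leqnn 1) Gtrig).
have s0 : 0 < s by exact: Gpos.
have G'pos i : 0 < G' i i by rewrite !mxE; exact: Gpos.
pose h (p : 'rV[R]_n) := @lebesgue_measure R [set x | A (row_cons (p, x))].
have mh : measurable_fun setT h by exact: measurable_fun_row_cons_section.
pose T (p : 'rV[R]_n) := p *m G'.
have inner p : (s%:E * @lebesgue_measure R
    [set x | A (row_cons (p, x) *m G)%R] = h (T p))%E.
  rewrite (_ : [set x | _] = [set x : R |
      [set y | A (row_cons (T p, y))] (s * x + (p *m g) 0 0)]); last first.
    by apply/seteqP; split=> x /=; rewrite row_cons_mul// sE.
  rewrite lebesgue_measure_affine// -xsection_row_cons.
  by apply: measurable_xsection; exact: measurable_preimage_row_cons.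
have mT : measurable_fun setT T by exact: measurable_mulmxr.
have D0 : 0 <= \prod_i G' i i by apply: prodr_ge0 => i _; exact: ltW.
(* The induction hypothesis says that mu is Lebesgue measure. *)
pose mu := mscale (NngNum D0) (pushforward (lebesgue_rV n) T).
have -> : \prod_i G i i = \prod_i G' i i * s.
  rewrite big_ord_recl mulrC; congr (_ * _); apply: eq_bigr => i _.
  by rewrite !mxE; congr (G _ _); exact: val_inj.
rewrite !lebesgue_rVS EFinM -muleA -ge0_integralZl//; last 2 first.
- apply: (@measurable_fun_row_cons_section _ _ [set v | A (v *m G)]).
  by rewrite -[X in measurable X]setTI; exact: measurable_mulmxr.
- by rewrite lee_fin ltW.
under eq_integral do rewrite inner.
transitivity (\int[mu mT]_p h p)%E.
  rewrite ge0_integral_mscale//; congr (_ * _)%E.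
  by rewrite [RHS]ge0_integral_pushforward.
by apply: eq_measure_integral => B mB _; rewrite -(IH G').
Qed.

Lemma index_allpairs_pair (T1 T2 : eqType) (s1 : seq T1) (s2 : seq T2) x y :
  x \in s1 -> y \in s2 ->
  index (x, y) [seq (a, b) | a <- s1, b <- s2] =
    (index x s1 * size s2 + index y s2)%N.
Proof.
move=> + ys; elim: s1 => [//|a s1 IH] /=; rewrite inE index_cat.
have inj c : injective (fun b : T2 => (c : T1, b)) by move=> ? ? [].
have [->|ax] := eqVneq a x.
  by rewrite (mem_map (inj x)) ys (index_map (inj x)) mul0n.
move=> /= /IH ->.
rewrite ifF; last by apply/negP => /mapP[b _ [xa _]]; rewrite xa eqxx in ax.
by rewrite size_map mulSn addnA.
Qed.

Lemma mxvec_indexE m n (i : 'I_m) (j : 'I_n) :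
  mxvec_index i j = (i * n + j)%N :> nat.
Proof.
rewrite /mxvec_index /=.
have -> : enum_rank (i, j) = index (i, j) (enum {: 'I_m * 'I_n}) :> nat.
  rewrite -[in RHS](nth_enum_rank (i, j) (i, j)) index_uniq ?enum_uniq//.
  by rewrite -cardE ltn_ord.
rewrite enumT unlock /= /prod_enum.
by rewrite index_allpairs_pair ?mem_enum// !index_enum_ord size_enum_ord.
Qed.

Lemma measurable_vec_mx (R : realType) m n :
  measurable_fun setT (vec_mx : 'rV[R]_(m * n) -> 'M[R]_(m, n)).
Proof.
apply/measurable_fun_mxP => i j; under eq_fun do rewrite mxE.
exact: measurable_mx_entry.
Qed.

(** On the row-major vector of entries, D |-> L D is the map v |-> v G, where G
    sends entry (i', j) to entry (i, j) with factor L i i'.  For L upper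
    triangular, G is lower triangular, and its diagonal repeats that of L
    m times. *)
Lemma lebesgue_mx_mul (R : realType) n m (L : 'M[R]_n) (A : set 'M[R]_(n, m)) :
  is_trig_mx L^T -> (forall i, 0 < L i i) -> measurable A ->
  ((\det L ^+ m)%:E * lebesgue_mx [set D | A (L *m D)] = lebesgue_mx A)%E.
Proof.
move=> Ltrig Lpos mA; rewrite /lebesgue_mx /pushforward.
pose G : 'M[R]_(n * m) := lin_mulmx L.
have GE i' j' i j : G (mxvec_index i' j') (mxvec_index i j) = L i i' *+ (j == j').
  rewrite /G /lin_mulmx /lin_mx /lin1_mx mxE /= -mxvec_delta mxvecK mxvecE.
  rewrite mxE (bigD1 i')//= big1 ?addr0; last first.
    by move=> k ki; rewrite mxE (negbTE ki) mulr0.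
  by rewrite mxE eqxx/= mulr_natr.
have Gtrig : is_trig_mx G.
  apply/is_trig_mxP => k l.
  case/mxvec_indexP: k => i' j'; case/mxvec_indexP: l => i j.
  rewrite !mxvec_indexE GE => kl; have [jj|] := eqVneq j j'; last by rewrite mulr0n.
  move: kl; rewrite jj ltn_add2r ltn_mul2r => /andP[_ ii].
  have /is_trig_mxP/(_ i' i ii) := Ltrig; rewrite mxE => ->.
  by rewrite mul0rn.
have Gpos k : 0 < G k k.
  by case/mxvec_indexP: k => i j; rewrite GE eqxx mulr1n.
have Gdet : \prod_k G k k = \det L ^+ m.
  rewrite (reindex _ (curry_mxvec_bij _ _)) /=.
  transitivity (\prod_(p : 'I_n * 'I_m) L p.1 p.1).
    by apply: eq_bigr => -[i j] _ /=; rewrite GE eqxx mulr1n.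
  rewrite -(pair_bigA _ (fun i (_ : 'I_m) => L i i))/=.
  under eq_bigr do rewrite prodr_const card_ord.
  rewrite prodrXl -det_tr det_trig//; congr (_ ^+ _).
  by apply: eq_bigr => i _; rewrite mxE.
rewrite -Gdet -(@lebesgue_rV_trig _ _ G (vec_mx @^-1` A))//; last first.
  by rewrite -[X in measurable X]setTI; exact: measurable_vec_mx.
congr (_ * lebesgue_rV _ _)%E; apply/seteqP; split=> v /=;
  by rewrite mul_rV_lin mxvecK.
Qed.

(** * Measurability of the spectral ball *)

(** The roots of the characteristic polynomial of D D^T - 1 are real.  If none
    is positive it is a product of polynomials with nonnegative coefficients;
    conversely a monic polynomial with nonnegative coefficients is positive
    on positive numbers.  This makes the ball a Borel set, the coefficients
    being polynomials in the entries of D. *)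
Lemma ball_char_polyP (R : rcfType) n m (D : 'M[R]_(n, m)) :
  spectral_ball n m D <->
    forall k, 0 <= (char_poly (D *m D^T - 1%:M))`_k.
Proof.
pose A := D *m D^T - 1%:M.
have AT : A^T = A by rewrite linearB/= tr_gram tr_scalar_mx.
have -> : spectral_ball n m D <-> psd (0%:M - A).
  by rewrite spectral_ballP /A raddf0 sub0r opprB.
rewrite -/A; split=> [pA|Ak].
  have [d Ad _] := sym_spectrum AT.
  rewrite Ad; apply: (big_ind (fun p : {poly R} => forall k, 0 <= p`_k)).
  - by move=> k; rewrite coef1; case: eqP.
  - by move=> p q p0 q0 k; rewrite coefM sumr_ge0// => i _; rewrite mulr_ge0.
  - move=> i _ k; rewrite coefB coefX coefC.
    have d0 : d 0 i <= 0.
      by apply: (psd_root_le pA); apply/(char_poly_rootP _ Ad); exists i.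
    by case: k => [|[|k]] /=; rewrite ?sub0r ?subr0 ?oppr_ge0 ?ler01.
apply: psd_of_root_ge0; first by rewrite linearB/= tr_scalar_mx AT.
move=> x; rewrite -[x]opprK -[- - x]sub0r root_char_poly_sub_scalar subr_ge0.
move: (- x) => y; rewrite leNgt; apply: contraTN => y0.
rewrite /root gt_eqF// horner_coef size_char_poly big_ord_recr/=.
have := char_poly_monic A; rewrite monicE lead_coefE size_char_poly /= => /eqP ->.
rewrite mul1r ltr_wpDl ?exprn_gt0//; apply: sumr_ge0 => i _.
by rewrite mulr_ge0// exprn_ge0// ltW.
Qed.

Lemma measurable_coef_prod d (T : measurableType d) (R : realType) I (s : seq I)
    (F : I -> T -> {poly R}) :
  (forall i k, measurable_fun setT (fun t => (F i t)`_k)) ->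
  forall k, measurable_fun setT (fun t => (\prod_(i <- s) F i t)`_k).
Proof.
move=> mF; elim: s => [|i s IH] k.
  by under eq_fun do rewrite big_nil; exact: measurable_cst.
under eq_fun do rewrite big_cons coefM.
by apply: measurable_sum => j; exact: measurable_funM.
Qed.

Lemma measurable_coef_char_poly d (T : measurableType d) (R : realType) n
    (A : T -> 'M[R]_n) :
  (forall i j, measurable_fun setT (fun t => A t i j)) ->
  forall k, measurable_fun setT (fun t => (char_poly (A t))`_k).
Proof.
move=> mA k; rewrite /char_poly /determinant.
under eq_fun do rewrite coef_sum.
apply: measurable_sum => s.
under eq_fun do rewrite -(rmorph_sign (@polyC R)) coefCM.
apply: measurable_funM; first exact: measurable_cst.
apply: measurable_coef_prod => i {}k.
under eq_fun do rewrite !mxE coefB coefC coefMn coefX.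
apply: measurable_funB; first exact: measurable_cst.
by case: (k == 0); [exact: mA|exact: measurable_cst].
Qed.

Lemma measurable_spectral_ball (R : realType) n m :
  measurable (spectral_ball n m : set 'M[R]_(n, m)).
Proof.
pose p (D : 'M[R]_(n, m)) := char_poly (D *m D^T - 1%:M).
rewrite (_ : spectral_ball n m =
    \bigcap_(k in [set: nat]) [set D | 0 <= (p D)`_k]); last first.
  apply/seteqP; split=> D; first by move=> /ball_char_polyP + k _; apply.
  by move=> H; apply/ball_char_polyP => k; exact: H.
apply: bigcap_measurable => // k _.
have mp : measurable_fun setT (fun D => (p D)`_k).
  apply: measurable_coef_char_poly => i j; under eq_fun do rewrite !mxE.
  apply: measurable_funB; last exact: measurable_cst.
  apply: measurable_sum => l; under eq_fun do rewrite mxE.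
  by apply: measurable_funM; exact: measurable_mx_entry.
rewrite -[X in measurable X]setTI (_ : [set D | _] = (fun D => (p D)`_k) @^-1` `[0, +oo[).
  exact: mp.
by apply/seteqP; split=> D /=; rewrite in_itv/= andbT.
Qed.

(** * Uniform matrices in the spectral ball *)

Lemma measurable_mulmx (R : realType) n m (L : 'M[R]_n)
    (A : set 'M[R]_(n, m)) :
  measurable A -> measurable [set D | A (L *m D)].
Proof.
move=> mA; rewrite -[X in measurable X]setTI.
suff : measurable_fun setT (fun D : 'M[R]_(n, m) => L *m D) by exact.
apply/measurable_fun_mxP => i j; under eq_fun do rewrite mxE.
apply: measurable_sum => k; apply: measurable_funM; first exact: measurable_cst.
exact: measurable_mx_entry.
Qed.

Lemma lebesgue_mx_ge0 (R : realType) n m (A : set 'M[R]_(n, m)) :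
  (0 <= lebesgue_mx A)%E.
Proof. exact: (measure_ge0 (lebesgue_rV (n * m))). Qed.

Lemma le_lebesgue_mx (R : realType) n m (A B : set 'M[R]_(n, m)) :
  measurable A -> measurable B -> A `<=` B ->
  (lebesgue_mx A <= lebesgue_mx B)%E.
Proof.
move=> mA mB AB; rewrite /lebesgue_mx /pushforward.
by apply: le_measure; rewrite ?inE; [| |exact: preimage_subset];
  rewrite -[X in measurable X]setTI; exact: measurable_vec_mx.
Qed.

(** Evaluating the uniform law on the whole space gives vol(B) / vol(B) = 1,
    which excludes vol(B) = 0 and vol(B) = +oo in extended arithmetic. *)
Lemma lebesgue_ball_fin d (Omega : measurableType d) (R : realType)
    (P : probability Omega R) n m (X : {RV P >-> 'M[R]_(n, m)}) :
  uniform_on (spectral_ball n m) X ->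
  exists2 b : R, 0 < b & lebesgue_mx (spectral_ball n m : set 'M[R]_(n, m)) = b%:E.
Proof.
set B := spectral_ball n m => Xunif.
have := Xunif _ measurableT; rewrite setTI probability_setT.
have : (0 <= lebesgue_mx B)%E by exact: lebesgue_mx_ge0.
case: (lebesgue_mx B) => [b| |]//=.
  rewrite lee_fin le_eqVlt => /predU1P[<- /eqP|b0 _]; last by exists b.
  by rewrite mul0e eqe oner_eq0.
by move=> _ /eqP; rewrite mule0 eqe oner_eq0.
Qed.

Lemma uniform_notin_ball d (Omega : measurableType d) (R : realType)
    (P : probability Omega R) n m (X : {RV P >-> 'M[R]_(n, m)}) :
  uniform_on (spectral_ball n m) X ->
  P (X @^-1` ~` spectral_ball n m) = 0%E.
Proof.
set B := spectral_ball n m => Xunif.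
have mBC : measurable (~` B) by apply: measurableC; exact: measurable_spectral_ball.
rewrite -[LHS]/(distribution P X (~` B)) (Xunif _ mBC) setICl.
by rewrite -[lebesgue_mx set0]/(lebesgue_rV _ set0) measure0 mul0e.
Qed.

(** This set is the image of the ball under the inverse of L, which divides
    volumes by det(L)^m. *)
Lemma uniform_shrunk_ball d (Omega : measurableType d) (R : realType)
    (P : probability Omega R) n m (X : {RV P >-> 'M[R]_(n, m)})
    (q : R) (L : 'M[R]_n) :
    uniform_on (spectral_ball n m) X ->
    is_trig_mx L^T -> (forall i, 0 < L i i) -> 0 < q -> 1 <= q * \det L ->
  (P (X @^-1` [set D | spectral_ball n m (L *m D)]) <= (q ^+ m)%:E)%E.
Proof.
set B := spectral_ball n m => Xunif Ltrig Lpos q0 qL.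
have [b b0 lB] := lebesgue_ball_fin Xunif.
have mB : measurable B by exact: measurable_spectral_ball.
have mE := measurable_mulmx L mB.
set E := [set _ | _] in mE *.
rewrite -[leLHS]/(distribution P X E) (Xunif _ mE) lB inver gt_eqF//.
have dL : 0 < \det L by rewrite -(pmulr_rgt0 _ q0) (lt_le_trans ltr01).
apply: (@le_trans _ _ (lebesgue_mx E * (b^-1)%:E)%E).
  apply: lee_wpmul2r; first by rewrite lee_fin invr_ge0 ltW.
  by apply: le_lebesgue_mx => //; exact: measurableI.
rewrite lee_pdivrMr// -lB -(lebesgue_mx_mul Ltrig Lpos mB) -/E muleA.
rewrite -[leLHS]mul1e; apply: lee_wpmul2r; first exact: lebesgue_mx_ge0.
by rewrite -EFinM lee_fin -exprMn exprn_ege1.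
Qed.

Lemma uniform_union_shrunk_balls d (Omega : measurableType d) (R : realType)
    (P : probability Omega R) n m (X : {RV P >-> 'M[R]_(n, m)})
    (q : R) (s : seq 'M[R]_n) :
    uniform_on (spectral_ball n m) X -> 0 < q ->
    (forall L, L \in s ->
      [/\ is_trig_mx L^T, forall i, 0 < L i i & 1 <= q * \det L]) ->
  let F := X @^-1` (~` spectral_ball n m `|`
    \bigcup_(L in [set` s]) [set D | spectral_ball n m (L *m D)]) in
  measurable F /\ (P F <= ((size s)%:R * q ^+ m)%:E)%E.
Proof.
set B := spectral_ball n m => Xunif q0; elim: s => [|L s IH] sP F.
  rewrite /F set_nil bigcup_set0 setU0 mul0r (uniform_notin_ball Xunif) lexx.
  split => //.
  rewrite -[X in measurable X]setTI; apply: measurable_funPT => //.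
  by apply: measurableC; exact: measurable_spectral_ball.
have [mF PF] := IH (fun M Ms => sP M (@mem_behead _ (L :: s) M Ms)).
pose E := X @^-1` [set D | B (L *m D)].
have mE : measurable E.
  rewrite -[X in measurable X]setTI; apply: measurable_funPT => //.
  by apply: measurable_mulmx; exact: measurable_spectral_ball.
have FE : F = E `|` X @^-1` (~` B `|` \bigcup_(L in [set` s]) [set D | B (L *m D)]).
  by rewrite /F !bigcup_seq big_cons setUCA preimage_setU.
rewrite FE; split; first exact: measurableU.
apply: (le_trans (measureU2 _ mE mF)).
have [Ltrig Lpos qL] := sP L (mem_head _ _).
rewrite /= -natr1 mulrDl mul1r addrC EFinD; apply: leeD => //.
exact: uniform_shrunk_ball.
Qed.

Lemma nneseries_geometric_lty (R : realType) (a q : R) (u : (\bar R)^nat) :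
  0 <= a -> 0 < q < 1 -> (forall k, 0 <= u k <= (a * q ^+ k)%:E)%E ->
  (\sum_(k <oo) u k < +oo)%E.
Proof.
move=> a0 /andP[q0 q1] uq.
apply: (@le_lt_trans _ _ (a / (1 - q))%:E); last exact: ltry.
apply: lime_le.
  by apply: is_cvg_nneseries => k _ _; have /andP[] := uq k.
apply: nearW => k.
apply: (@le_trans _ _ (\sum_(0 <= i < k) (a * q ^+ i)%:E)%E).
  by apply: lee_sum => i _; have /andP[] := uq i.
by rewrite sumEFin lee_fin geometric_le_lim// gtr0_norm.
Qed.

(** Outside the ball lies a null set, and inside it sigma_n <= r forces Delta_m
    into one of the finitely many sets of [finite_cover], each of probability
    at most q^m. *)
Lemma ae_sigma_gt (R : realType) d (Omega : measurableType d)
    (P : probability Omega R) n (Delta : forall m, {RV P >-> 'M[R]_(n, m)})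
    (r : R) : (0 < n)%N ->
  (forall m, (n <= m)%N -> uniform_on (spectral_ball n m) (Delta m)) ->
  0 <= r < 1 ->
  exists N : set Omega, P.-negligible N /\
    forall w, ~ N w -> \forall m \near \oo, r < sigma n (Delta m w) <= 1.
Proof.
move=> n_ge1 Delta_unif r01.
have [q q01 [s [sP scover]]] := finite_cover n_ge1 r01.
(* The law of Delta_m is prescribed for m >= n, hence the empty sets before. *)
pose F m := if (n <= m)%N then Delta m @^-1` (~` spectral_ball n m `|`
  \bigcup_(L in [set` s]) [set D | spectral_ball n m (L *m D)]) else set0.
have mPF m : measurable (F m) /\ (P (F m) <= ((size s)%:R * q ^+ m)%:E)%E.
  rewrite /F; case: ifPn => nm.
    by apply: uniform_union_shrunk_balls => //; [exact: Delta_unif|case/andP: q01].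
  have /andP[/ltW q0 _] := q01.
  by rewrite measure0 lee_fin mulr_ge0// exprn_ge0.
have mF m : measurable (F m) by have [] := mPF m.
exists (lim_sup_set F); split.
  apply/negligibleP.
    by apply: bigcap_measurable => // j _; apply: bigcup_measurable.
  apply: lim_sup_set_cvg0 => //.
  apply: (nneseries_geometric_lty (ler0n R (size s)) q01) => m.
  by rewrite measure_ge0; have [] := mPF m.
move=> w /existsNP[j /not_implyP[_ wF]].
near=> m.
have nm : (n <= m)%N by near: m; exact: nbhs_infty_ge.
have : ~ F m w.
  by move=> Fmw; apply: wF; exists m => //=; near: m; exact: nbhs_infty_ge.
rewrite /F nm /= => /not_orP[/contrapT wB wE].
have [x [/andP[x0 x1] rx sx]] := sigma_ball n_ge1 wB.
rewrite sx -[X in _ <= X]sqrtr1 ler_sqrt// x1 andbT ltNge; apply/negP => xr.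
have /andP[r0 r1] := r01.
have [L Ls] : exists2 L, L \in s &
    psd (1%:M - L *m (Delta m w *m (Delta m w)^T) *m L^T).
  apply: scover; [exact: tr_gram|exact: psd_gram|exact/spectral_ballP|].
  (* sqrt x <= r < 1 gives x <= r^2 <= r. *)
  exists x => //; rewrite -(sqr_sqrtr x0) expr2.
  by rewrite (le_trans (ler_pM _ _ xr xr))// ler_piMr// ltW.
rewrite -mulmxA -mulmxA -trmx_mul mulmxA => /spectral_ballP wL.
by apply: wE; exists L.
Unshelve. all: by end_near. Qed.

Theorem theorem2 (R : realType) (d : measure_display) (Omega : measurableType d)
    (P : probability Omega R) (n : nat) (n_ge1 : (1 <= n)%N)
    (Delta : forall m : nat, {RV P >-> 'M[R]_(n, m)})
    (Delta_unif : forall m : nat, (n <= m)%N ->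
       uniform_on (spectral_ball n m) (Delta m)) :
  {ae P, forall w, sigma n (Delta m w) @[m --> \oo] --> (1 : R)}.
Proof.
pose r k : R := 1 - k.+1%:R^-1.
have r01 k : 0 <= r k < 1.
  by rewrite subr_ge0 invf_le1 ?ltr0n// ler1n/= ltrBlDr ltrDl invr_gt0 ltr0n.
have [N HN] := choice (fun k => ae_sigma_gt n_ge1 Delta_unif (r01 k)).
apply: (negligibleS (A := \bigcup_k N k)); last first.
  by apply: negligible_bigcup => k; have [] := HN k.
move=> w /= nw; apply: contrapT => wN; apply: nw.
apply/cvgrPdist_lt => e e0.
have [k _ /(_ k (leqnn k)) ke] := near_infty_natSinv_lt (PosNum e0).
have : ~ N k w by move=> Nkw; apply: wN; exists k.
have [_ Nk] := HN k; move=> /Nk; apply: filterS => m /andP[rs s1].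
rewrite ger0_norm ?subr_ge0// ltrBlDr -ltrBlDl.
by apply: le_lt_trans rs; rewrite lerB// ltW.
Qed.
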